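(* There is a universal constant $C>0$ such that the following holds. Let $d\ge2$, $n_1,\dots,n_d,m,r$ be positive integers, $R>0$, and $\delta,\varepsilon\in(0,1)$. Let $\mathcal{A}:\mathbb{R}^{n_1\times\cdots\times n_d}\to\mathbb{R}^m$ be the linear map represented by a tensor in $\mathbb{R}^{n_1\times\cdots\times n_d\times m}$ whose entries are i.i.d. Gaussian random variables with mean zero and variance $1/m$. If $$m\ge C\delta^{-2}\cdot\max\Big\{\log(\varepsilon^{-1}),\ r\log(drR^d)\sum_{i=1}^d n_i\Big\},$$ then with probability at least $1-\varepsilon$, $\mathcal{A}$ satisfies the TRIP adapted to $S_{r,R}$ with parameter $\delta_r=\delta$.
   Context: The map represented by a tensor $(a_{i_1\cdots i_d k})$ is $\mathcal{A}(\boldsymbol{X})_k=\sum_{i_1,\dots,i_d}a_{i_1\cdots i_d k}\boldsymbol{X}_{i_1\cdots i_d}$ for $1\le k\le m$. $\|\cdot\|_F$ is the Frobenius norm (the $\ell_2$ norm of the entries), and $\otimes$ is the outer product of vectors. $$S_{r,R}=\Big\{\boldsymbol{X}\in\mathbb{R}^{n_1\times\cdots\times n_d}:\|\boldsymbol{X}\|_F=1,\ \boldsymbol{X}=\sum_{i=1}^r\boldsymbol{x}_{i1}\otimes\cdots\otimes\boldsymbol{x}_{id},\ \boldsymbol{x}_{ij}\in\mathbb{R}^{n_j},\ \|\boldsymbol{x}_{ij}\|_2\le R\Big\}.$$ $\mathcal{A}$ satisfies the TRIP adapted to $S_{r,R}$ with parameter $\delta_r>0$ if $(1-\delta_r)\|\boldsymbol{X}\|_F^2\le\|\mathcal{A}(\boldsymbol{X})\|_2^2\le(1+\delta_r)\|\boldsymbol{X}\|_F^2$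 for all $\boldsymbol{X}\in S_{r,R}$. *)

(* Defs.v *)
From HB Require Import structures.
From mathcomp Require Import all_boot all_order all_algebra.
From mathcomp Require Import all_classical all_reals all_analysis.

Set Implicit Arguments.
Unset Strict Implicit.
Unset Printing Implicit Defensive.

Import Order.TTheory GRing.Theory Num.Theory.
Import numFieldNormedType.Exports.

Local Open Scope classical_set_scope.
Local Open Scope ring_scope.

(* The library norm `|_| on matrices is the max norm, hence this definition.
   It serves as the Euclidean norm of vectors and the Frobenius norm of
   tensors. *)
Definition l2norm (R : realType) (I : finType) (f : I -> R) : R :=
  Num.sqrt (\sum_(i : I) f i ^+ 2).

Definition midx (d : nat) (n : 'I_d -> nat) : finType :=
  {dffun forall j : 'I_d, 'I_(n j)}.

Definition tensor (R : realType) (d : nat) (n : 'I_d -> nat) : lmodType R :=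
  {ffun midx n -> R}.

Definition frobenius (R : realType) (d : nat) (n : 'I_d -> nat)
    (X : tensor R n) : R :=
  l2norm X.

Definition norm2 (R : realType) (k : nat) (v : 'rV[R]_k) : R :=
  l2norm (fun i : 'I_k => v ord0 i).

Definition outer (R : realType) (d : nat) (n : 'I_d -> nat)
    (x : forall j : 'I_d, 'rV[R]_(n j)) : tensor R n :=
  [ffun i : midx n => \prod_(j < d) x j ord0 (i j)].

Definition bounded_cp_set (R : realType) (d : nat) (n : 'I_d -> nat) (r : nat)
    (rho : R) : set (tensor R n) :=
  [set X | frobenius X = 1 /\
     exists x : 'I_r -> forall j : 'I_d, 'rV[R]_(n j),
       X = \sum_(i < r) outer (x i) /\
       forall (i : 'I_r) (j : 'I_d), norm2 (x i j) <= rho].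

(* A tensor of format n_1 x ... x n_d x m is indexed by pairs (i, k) with
   i a multi-index and k : 'I_m. *)
Definition tensor_map (R : realType) (d : nat) (n : 'I_d -> nat) (m : nat)
    (a : {ffun midx n * 'I_m -> R}) (X : tensor R n) : 'rV[R]_m :=
  \row_(k < m) \sum_(i : midx n) a (i, k) * X i.

Definition TRIP (R : realType) (d : nat) (n : 'I_d -> nat) (m : nat)
    (A : tensor R n -> 'rV[R]_m) (S : set (tensor R n)) (delta : R) : Prop :=
  forall X : tensor R n, S X ->
    (1 - delta) * frobenius X ^+ 2 <= norm2 (A X) ^+ 2 /\
    norm2 (A X) ^+ 2 <= (1 + delta) * frobenius X ^+ 2.

Definition independent_RVs (R : realType) (disp : measure_display)
    (T : measurableType disp) (P : probability T R) (I : finType)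
    (X : I -> {RV P >-> R}) : Prop :=
  forall (J : {set I}) (B : I -> set R), (forall i, measurable (B i)) ->
    P (\bigcap_(i in [set` J]) (X i @^-1` B i)) =
    (\prod_(i in J) P (X i @^-1` B i))%E.

(* sigma is the standard deviation. The laws are only compared on measurable
   sets: as functions on all sets their values elsewhere are meaningless. *)
Definition has_normal_law (R : realType) (disp : measure_display)
    (T : measurableType disp) (P : probability T R)
    (X : {RV P >-> R}) (mu sigma : R) : Prop :=
  forall B : set R, measurable B ->
    distribution P X B = normal_prob mu sigma B.

(* Main.v *)
Require Import Defs.
From HB Require Import structures.
From mathcomp Require Import all_boot all_order all_algebra.
From mathcomp Require Import all_classical all_reals all_analysis.
From mathcomp Require Import measurable_realfun.
From mathcomp Require Import ring lra.

Set Implicit Arguments.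
Unset Strict Implicit.
Unset Printing Implicit Defensive.

Import Order.TTheory GRing.Theory Num.Theory.
Import numFieldNormedType.Exports.

Local Open Scope classical_set_scope.
Local Open Scope ring_scope.

(** Write [q(W) = |A W|^2 - |W|^2] for the distortion of a tensor [W].  On unit
tensors TRIP says that [|q| <= delta], so the theorem is a uniform bound for
the random quadratic form [q] over [S], the set of unit tensors of bounded
CP rank.  When [S] is empty there is nothing to prove; otherwise comparing
norms gives [r rho^d >= 1], so that [Lam = d r rho^d >= 2] and its logarithm
can absorb constants.

A single tensor: integrating the Gaussian entries out one at a time, each
step being the explicit integral [normal_exp_sqr] of the exponential of a
square, gives a closed formula for the exponential moments of the squared
row sums ([expectation_exp_quadratic]).  Hence [E exp(s m q(W))] is at most
[exp(4 m s^2)] for [|W| <= 1] and [|s| <= 1/4]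
([expectation_exp_distortion]).

Entropy: [S] lies in the image of a ball of dimension
[N = r (n_1 + ... + n_d)] under the multilinear map [cp_tensor], whose
Lipschitz constant is explicit ([cp_tensor_lipschitz]).  Cutting the ball into cubes and counting the cubes
by a generating function ([euclidean_cells]) gives, at each resolution
[2^-k], a net of [S] with at most [(16 Lam 2^k)^N] points
([bounded_cp_nets]).  Its logarithm grows only linearly in [k].

Chaining: a single net does not suffice, because the difference of a tensor
and its nearest net point, once normalized, need not lie in [S], and then [q]
on [S] says nothing about it.  Telescope instead along nets of resolution
[2^-k].  If [|x - y| <= 2^-k] then [q(x) - q(y)] is
[2^-k] times a combination of two values of [q] in the unit ball
([distortion_link]).  Allowing these values to be of order [delta (k + 1)]
at level [k] keeps the telescoped sum of order [delta], since the sum of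
[(k + 1) 2^-k] converges ([chain_bound]).  The probability that level [k]
fails is at most [exp(- c m delta^2 (k + 1))] times the number of pairs; with
[m delta^2] a large multiple of [max(N log Lam, log(1/eps))] this is below
[eps 2^-(k+1)] ([chaining_probability]).

The nets are countable, their union is dense in [S] and [q] is continuous, so
the event of the theorem is the event that [|q| <= delta] on all nets
([distortion_dense]).  This also shows that it is measurable. *)

(** * Gaussian integrals of exponentials of squares *)

Section gaussian_integral.
Context {R : realType}.
Local Notation leb := (@lebesgue_measure R).

Lemma ge0_integral_normal_prob (mean sd : R) (f : R -> \bar R) :
  measurable_fun setT f -> (forall x, 0 <= f x)%E ->
  (\int[normal_prob mean sd]_x f x =
   \int[leb]_x (f x * (normal_pdf mean sd x)%:E))%E.
Proof.
move=> mf f0.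
pose g := Radon_Nikodym_SigmaFinite.f (normal_prob mean sd) leb.
have dom := normal_prob_dominates mean sd.
rewrite -(Radon_Nikodym_SigmaFinite.change_of_variables dom f0) //.
have mpdf : measurable_fun setT (fun x => (normal_pdf mean sd x)%:E).
  by apply/measurable_EFinP; exact: measurable_normal_pdf.
have ig : leb.-integrable setT g by exact: Radon_Nikodym_SigmaFinite.f_integrable.
apply: ae_eq_integral => //.
- by apply: emeasurable_funM => //; exact: measurable_int ig.
- exact: emeasurable_funM.
- apply: ae_eqe_mul2l; apply: integral_ae_eq => // A _ mA.
  by rewrite -Radon_Nikodym_SigmaFinite.f_integral.
Qed.

(** Completing the square turns the product of the normal density and
[expR (c * (z + w * y) ^+ 2)] into a multiple of the density of another normal
law, of variance [sd ^+ 2 / D].  The result is again the exponential of a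
multiple of [z ^+ 2], which is what lets Gaussian variables be integrated out
one after the other. *)
Lemma normal_exp_sqr (sd c z w : R) : 0 < sd -> 2 * c * sd ^+ 2 * w ^+ 2 < 1 ->
  let D := 1 - 2 * c * sd ^+ 2 * w ^+ 2 in
  (\int[normal_prob 0 sd]_y (expR (c * (z + w * y) ^+ 2))%:E =
   ((Num.sqrt D)^-1 * expR (c / D * z ^+ 2))%:E)%E.
Proof.
move=> sd0 cw D.
have D0 : 0 < D by rewrite subr_gt0.
have sD0 : 0 < Num.sqrt D by rewrite sqrtr_gt0.
rewrite ge0_integral_normal_prob; last 2 first.
- apply/measurable_EFinP; apply: measurableT_comp => //.
  apply: measurable_funM => //; apply: measurable_funX.
  by apply: measurable_funD => //; exact: measurable_funM.
- by move=> y; rewrite lee_fin expR_ge0.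
pose mean := 2 * c * z * w * sd ^+ 2 / D.
pose sd' := sd / Num.sqrt D.
have sd'0 : sd' != 0 by rewrite gt_eqF // divr_gt0.
have sdn0 : sd != 0 by rewrite gt_eqF.
transitivity (\int[leb]_y ((((Num.sqrt D)^-1 * expR (c / D * z ^+ 2))%:E)
   * (normal_pdf mean sd' y)%:E))%E.
  apply: eq_integral => y _; rewrite -!EFinM; congr EFin.
  rewrite !normal_pdfE // /normal_fun.
  have -> : normal_peak sd = (Num.sqrt D)^-1 * normal_peak sd'.
    rewrite /normal_peak /sd' expr_div_n sqr_sqrtr ?ltW //.
    have -> : sd ^+ 2 * pi *+ 2 = D * (sd ^+ 2 / D * pi *+ 2).
      by field; rewrite gt_eqF.
    by rewrite sqrtrM ?ltW // invfM.
  rewrite [LHS]mulrCA [RHS]mulrACA; congr (_ * _).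
  rewrite -!expRD; congr expR.
  rewrite /mean /sd' expr_div_n sqr_sqrtr ?ltW // /D; field.
  by rewrite sdn0 gt_eqF.
rewrite ge0_integralZl //.
- by rewrite integral_normal_pdf mule1.
- by apply/measurable_EFinP; exact: measurable_normal_pdf.
- by move=> y _; rewrite lee_fin normal_pdf_ge0.
Qed.

End gaussian_integral.

(** * Independence and integration of one variable *)

Section independence_fubini.
Context {R : realType} {disp : measure_display} {T : measurableType disp}.
Variables (P : probability T R) (I : finType) (X : I -> {RV P >-> R}).

Definition cylinders (J : {set I}) : set (set T) :=
  [set A | exists2 B : I -> set R, (forall i, measurable (B i)) &
     A = \bigcap_(i in [set` J]) (X i @^-1` B i)].

Lemma measurable_preimage_RV (Y : {RV P >-> R}) (B : set R) :
  measurable B -> measurable (Y @^-1` B).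
Proof. by move=> mB; rewrite -[X in measurable X]setTI; exact: measurable_funP. Qed.

Lemma cylinders_measurable J : cylinders J `<=` measurable.
Proof.
move=> _ [B mB ->]; apply: fin_bigcap_measurable => // i _.
exact: measurable_preimage_RV.
Qed.

Lemma cylindersT J : cylinders J setT.
Proof.
by exists (fun=> setT) => //; apply/seteqP; split => // w _ i _.
Qed.

Lemma cylindersI J : setI_closed (cylinders J).
Proof.
move=> _ _ [B mB ->] [C mC ->]; exists (fun i => B i `&` C i).
  by move=> i; exact: measurableI.
by rewrite -bigcapI.
Qed.

Lemma measurable_cylinders (J : {set I}) i : i \in J ->
  measurable_fun setT (X i : g_sigma_algebraType (cylinders J) -> R).
Proof.
move=> iJ _ B mB; rewrite setTI; apply: sub_sigma_algebra.
exists (fun j => if j == i then B else setT) => [j|]; first by case: ifP.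
apply/seteqP; split => w /=.
  by move=> Bw j _; rewrite /=; case: eqP => // ->.
by move=> /(_ i iJ) /=; rewrite eqxx.
Qed.

Lemma measurable_id_cylinders J :
  measurable_fun setT (id : T -> g_sigma_algebraType (cylinders J)).
Proof.
move=> _ B mB; rewrite setTI preimage_id.
apply: (@smallest_sub _ _ (cylinders J)) mB => //.
- exact: sigma_algebra_measurable.
- exact: cylinders_measurable.
Qed.

Hypothesis indX : independent_RVs X.

(** Independence is only assumed for events [X i @^-1` B i]; the cylinder sets
are stable under intersection, so it extends to the sigma-algebra that they
generate. *)
Lemma independent_cylinders (J : {set I}) l (A : set R) (B : set T) :
  l \notin J -> measurable A -> <<s cylinders J >> B ->
  P (X l @^-1` A `&` B) = (P (X l @^-1` A) * P B)%E.
Proof.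
move=> lJ mA sB; have mXA := measurable_preimage_RV (X l) mA.
have pA : (0 <= fine (P (X l @^-1` A)))%R by rewrite fine_ge0.
pose m2 := mscale (NngNum pA) P.
have -> : P (X l @^-1` A `&` B) = mrestr P mXA B by rewrite /mrestr setIC.
have -> : (P (X l @^-1` A) * P B)%E = m2 B.
  by rewrite /m2 /mscale /= fineK // fin_num_measure.
apply: (g_sigma_algebra_measure_unique (cylinders J) _ (fun=> setT)) sB => //.
- exact: cylinders_measurable.
- by move=> _; exact: cylindersT.
- by rewrite bigcup_const.
- exact: cylindersI.
- move=> _ [C mC ->]; rewrite /= /mrestr /m2 /mscale /= fineK ?fin_num_measure //.
  pose C' i := if i == l then A else C i.
  have mC' i : measurable (C' i) by rewrite /C'; case: ifP.
  have := indX (l |: J) mC'.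
  rewrite big_setU1 //= {2}/C' eqxx (eq_bigr (fun i => P (X i @^-1` C i))); last first.
    move=> i iJ; rewrite /C'; case: eqP => // il.
    by rewrite -il iJ in lJ.
  rewrite -(indX J mC) => <-; congr (P _); apply/seteqP; split => w /=.
    move=> [Cw Aw] i /=; rewrite !inE /C' => /orP[/eqP ->|iJ].
      by rewrite eqxx.
    case: eqP => [il|_]; first by rewrite -il iJ in lJ.
    exact: Cw.
  move=> Cw; split.
    move=> i /= iJ; have /Cw : i \in l |: J by rewrite !inE iJ orbT.
    by rewrite /C' /=; case: eqP => // il; rewrite -il iJ in lJ.
  have /Cw : l \in l |: J by rewrite setU11.
  by rewrite /= /C' eqxx.
- by move=> _; rewrite /= /mrestr setTI (le_lt_trans (probability_le1 _ _)) ?ltry.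
Qed.

(** Fubini for a variable that is independent of the others: as [f] depends on
the second component only through the variables indexed by [J], [X l] may be
integrated out with that component held fixed.  The second component is the
sample point itself, seen in the coarser sigma-algebra, which avoids any
product of copies of [R]. *)
Lemma ge0_integral_independent (J : {set I}) l
    (f : R * g_sigma_algebraType (cylinders J) -> \bar R) :
  l \notin J -> measurable_fun setT f -> (forall x, 0 <= f x)%E ->
  (\int[P]_w f (X l w, w) =
   \int[P]_w \int[distribution P (X l)]_y f (y, w))%E.
Proof.
move=> lJ mf f0.
pose T' := g_sigma_algebraType (cylinders J).
have mid := @measurable_id_cylinders J.
have mjoint : measurable_fun setT (fun w : T => (X l w, w : T')).
  by apply/measurable_fun_pair => //; exact: measurable_funP.
pose idT' : {RV P >-> T'} := mfun_Sub (mem_set mid).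
pose joint : {RV P >-> (R * T')%type} := mfun_Sub (mem_set mjoint).
have law : forall A, measurable A ->
    (distribution P (X l) \x distribution P idT')%E A = distribution P joint A.
  apply: product_measure_unique => A B mA mB.
  exact: (independent_cylinders lJ mA mB).
rewrite -[LHS](ge0_integral_distribution joint mf) //.
rewrite -(eq_measure_integral _ (fun A mA _ => law A mA)).
rewrite fubini_tonelli2 // /fubini_G ge0_integral_distribution //.
  exact: measurable_fun_fubini_tonelli_G.
by move=> w; exact: integral_ge0.
Qed.
End independence_fubini.

(** The display of the Borel sets on [R] and the one under which
    [normal_prob] is built are different; transporting along the identity
    reconciles them. *)
Lemma ge0_integral_normal_law (R : realType) (disp : measure_display)
    (T : measurableType disp) (P : probability T R) (X : {RV P >-> R})
    (mean sd : R) (f : R -> \bar R) :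
  has_normal_law X mean sd -> measurable_fun setT f -> (forall x, 0 <= f x)%E ->
  (\int[distribution P X]_y f y = \int[normal_prob mean sd]_y f y)%E.
Proof.
move=> nX mf f0.
have mid : measurable_fun setT (id : measurableTypeR R -> R).
  by move=> _ B mB; rewrite setTI preimage_id.
rewrite -[RHS](@ge0_integral_pushforward _ _ _ _ _ _ mid _ setT f) //.
by apply: eq_measure_integral => A mA _; exact: nX.
Qed.

(** * Exponential moments of Gaussian quadratic forms *)

Section gaussian_chaos.
Context {R : realType} {disp : measure_display} {T : measurableType disp}.
Variables (P : probability T R) (L K : finType) (X : L -> {RV P >-> R}).
Variables (sd : R) (row : L -> K) (w : L -> R).
Hypothesis sd0 : 0 < sd.
Hypothesis indX : independent_RVs X.
Hypothesis normX : forall l, has_normal_law (X l) 0 sd.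

(* The rows partition the variables, and [u] spreads the weights over them:
   [Z J k] is the part of the [k]-th row sum carried by [J], and [V J k] is its
   variance up to the factor [sd ^+ 2]. *)
Let u l k := if row l == k then w l else 0.
Let Z (J : {set L}) k t := \sum_(l in J) u l k * X l t.
Let V (J : {set L}) k := \sum_(l in J) u l k ^+ 2.

Let V_ge0 J k : 0 <= V J k.
Proof. by apply: sumr_ge0 => l _; exact: sqr_ge0. Qed.

Let measurable_Z J k :
  measurable_fun setT (Z J k : g_sigma_algebraType (cylinders X J) -> R).
Proof.
rewrite /Z; under eq_fun do rewrite big_mkcond /=.
apply: measurable_sum => l; case: (boolP (l \in J)) => lJ; last exact: measurable_cst.
by apply: measurable_funM => //; exact: measurable_cylinders.
Qed.

(** Induction on [J]: integrating out [X l] multiplies the expectation by a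
constant and replaces the coefficient [c r] of its row [r] by [c r / D], and
the constants multiply up along each row.  The coefficients must therefore be
arbitrary in the induction, even if only a constant [c] is of interest. *)
Lemma expectation_exp_quadratic (J : {set L}) (c : K -> R) :
  (forall k, 2 * c k * sd ^+ 2 * V J k < 1) ->
  (\int[P]_t (expR (\sum_k c k * Z J k t ^+ 2))%:E =
   (\prod_k (Num.sqrt (1 - 2 * c k * sd ^+ 2 * V J k))^-1)%:E)%E.
Proof.
have [n] := ubnP #|J|; elim: n J c => // n IHn J c /ltnSE Jn hc.
have [->|[l lJ]] := set_0Vmem J.
  rewrite /Z /V; under eq_integral do under eq_bigr do rewrite big_set0 expr0n mulr0.
  under [in RHS]eq_bigr do rewrite big_set0 mulr0 subr0 sqrtr1 invr1.
  by rewrite !big1 // expR0 integral_cst //= probability_setT mule1.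
pose J' := J :\ l.
have lJ' : l \notin J' by rewrite !inE eqxx.
have J'n : (#|J'| < n)%N by rewrite (leq_trans _ Jn) // [X in (_ < X)%N](cardsD1 l) lJ.
have ZE k t : Z J k t = u l k * X l t + Z J' k t.
  by rewrite /Z -(finset.setD1K lJ) big_setU1.
have VE k : V J k = u l k ^+ 2 + V J' k.
  by rewrite /V -(finset.setD1K lJ) big_setU1.
pose r := row l.
have ur : u l r = w l by rewrite /u eqxx.
have uk k : k != r -> u l k = 0 by rewrite /u eq_sym => /negbTE ->.
have hD : 2 * c r * sd ^+ 2 * w l ^+ 2 < 1.
  have := hc r; rewrite VE ur => h.
  have [c0|c0] := leP 0 (c r).
    apply: le_lt_trans h; rewrite mulrDr lerDl mulr_ge0 ?V_ge0 //.
    by rewrite mulr_ge0 ?sqr_ge0 // mulr_ge0.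
  apply: (@le_lt_trans _ _ 0) => //.
  by rewrite mulr_le0_ge0 ?sqr_ge0 // mulr_le0_ge0 ?sqr_ge0 // mulr_ge0_le0 // ltW.
pose D := 1 - 2 * c r * sd ^+ 2 * w l ^+ 2.
have D0 : 0 < D by rewrite subr_gt0.
pose c' k := if k == r then c r / D else c k.
pose f (p : R * g_sigma_algebraType (cylinders X J')) :=
  (expR (\sum_k c k * (u l k * p.1 + Z J' k p.2) ^+ 2))%:E.
transitivity (\int[P]_t f (X l t, t))%E.
  by apply: eq_integral => t _; rewrite /f; under eq_bigr do rewrite ZE.
rewrite ge0_integral_independent //; last 2 first.
- apply/measurable_EFinP; apply: measurableT_comp => //.
  apply: measurable_sum => k; apply: measurable_funM => //.
  apply: measurable_funX; apply: measurable_funD.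
    by apply: measurable_funM => //; exact: measurable_fst.
  exact: (measurableT_comp (@measurable_Z J' k) measurable_snd).
- by move=> p; rewrite lee_fin expR_ge0.
transitivity (\int[P]_t ((Num.sqrt D)^-1%:E *
    (expR (\sum_k c' k * Z J' k t ^+ 2))%:E))%E.
  apply: eq_integral => t _.
  transitivity (\int[normal_prob 0 sd]_y f (y, t))%E.
    apply: ge0_integral_normal_law => // [|y]; last by rewrite lee_fin expR_ge0.
    apply/measurable_EFinP; apply: measurableT_comp => //=.
    apply: measurable_sum => k; apply: measurable_funM => //.
    apply: measurable_funX; apply: measurable_funD => //.
  pose E := \sum_(k | k != r) c k * Z J' k t ^+ 2.
  transitivity (\int[normal_prob 0 sd]_y
     ((expR E)%:E * (expR (c r * (Z J' r t + w l * y) ^+ 2))%:E))%E.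
    apply: eq_integral => y _; rewrite -EFinM -expRD; congr (expR _)%:E.
    rewrite (bigD1 r) //= ur addrC [X in _ * X ^+ 2]addrC; congr (_ + _).
    by apply: eq_bigr => k kr; rewrite uk // mul0r add0r.
  rewrite ge0_integralZl //; last first.
    apply/measurable_EFinP; apply: measurableT_comp => //.
    apply: measurable_funM => //; apply: measurable_funX.
    by apply: measurable_funD => //; exact: measurable_funM.
  rewrite normal_exp_sqr // -!EFinM -/D; congr EFin.
  rewrite mulrCA -expRD; congr (_ * expR _).
  rewrite [RHS](bigD1 r) //= /c' eqxx addrC; congr (_ + _).
  by apply: eq_bigr => k /negbTE ->.
have hc' k : 2 * c' k * sd ^+ 2 * V J' k < 1.
  rewrite /c'; case: eqP => [->|/eqP kr]; last first.
    by have := hc k; rewrite VE uk // expr0n add0r.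
  have := hc r; rewrite VE ur => h.
  rewrite (_ : _ * V J' r = (2 * c r * sd ^+ 2 * V J' r) / D); last by field; rewrite gt_eqF.
  by rewrite ltr_pdivrMr // mul1r /D; lra.
rewrite ge0_integralZl //.
- rewrite IHn // -EFinM; congr EFin.
  rewrite (bigD1 r) //= [in RHS](bigD1 r) //= mulrA; congr (_ * _).
    rewrite -invfM -sqrtrM ?ltW // VE ur /c' eqxx; congr (Num.sqrt _)^-1.
    by rewrite /D; field; rewrite gt_eqF.
  by apply: eq_bigr => k kr; rewrite VE uk // /c' (negbTE kr) expr0n add0r.
- apply/measurable_EFinP; apply: measurableT_comp => //.
  apply: measurable_sum => k; apply: measurable_funM => //.
  apply: measurable_funX.
  exact: (measurableT_comp (@measurable_Z J' k) (@measurable_id_cylinders _ _ _ _ _ _ _)).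
Qed.

End gaussian_chaos.

Definition distortion {R : realType} {F : finType} {m : nat}
    (a : F * 'I_m -> R) (W : {ffun F -> R}) : R :=
  \sum_k (\sum_i a (i, k) * W i) ^+ 2 - \sum_i W i ^+ 2.

Lemma distortion0 {R : realType} {F : finType} {m : nat} (a : F * 'I_m -> R) :
  distortion a 0 = 0.
Proof.
rewrite /distortion !big1 ?subr0 // => [i _|k _]; first by rewrite ffunE expr0n.
by rewrite big1 ?expr0n // => i _; rewrite ffunE mulr0.
Qed.

(** After taking logarithms this is a second order estimate for the logarithm
at 1.  It follows from [1 + u <= expR u] with [u = y + 2 * y ^+ 2], because
[(1 - y) * (1 + y + 2 * y ^+ 2) = 1 + y ^+ 2 * (1 - 2 * y)]. *)
Lemma invr_sqrt_le_expR {R : realType} (y : R) : y <= 1 / 2 ->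
  (Num.sqrt (1 - y))^-1 <= expR (y / 2 + y ^+ 2).
Proof.
move=> y2; have y1 : 0 < 1 - y by lra.
rewrite -[leRHS]invrK lef_pV2 ?posrE ?sqrtr_gt0 ?invr_gt0 ?expR_gt0 //.
rewrite -expRN -(ger0_norm (expR_ge0 _)) -sqrtr_sqr ler_wsqrtr //.
rewrite -expRM_natl -[leRHS]invrK.
rewrite (_ : _ * _ = - (y + 2 * y ^+ 2)); last by field.
rewrite expRN lef_pV2 ?posrE ?invr_gt0 ?expR_gt0 //.
apply: le_trans (expR_ge1Dx _); rewrite -div1r ler_pdivrMr //.
have : 0 <= y ^+ 2 * (1 - 2 * y) by rewrite mulr_ge0 ?sqr_ge0 //; lra.
by nra.
Qed.

Section distortion_mgf.
Context {R : realType} {disp : measure_display} {T : measurableType disp}.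
Variables (P : probability T R) (F : finType) (m : nat).
Variables (a : F * 'I_m -> {RV P >-> R}).

Lemma measurable_distortion W :
  measurable_fun setT (fun t : T => distortion (a ^~ t) W).
Proof.
apply: measurable_funB => //; apply: measurable_sum => k.
by apply: measurable_funX; apply: measurable_sum => i; exact: measurable_funM.
Qed.

Hypothesis m0 : (0 < m)%N.
Hypothesis indep_a : independent_RVs a.
Hypothesis norm_a : forall l, has_normal_law (a l) 0 (Num.sqrt m%:R^-1).

(** The first order terms of [(1 - 2 * s * v) ^ (- m / 2)] and of
[expR (- s * m * v)] cancel, where [v] is the squared norm of [W]; what is left
is of order [m * s ^+ 2]. *)
Lemma expectation_exp_distortion (s : R) (W : {ffun F -> R}) :
  `|s| <= 1 / 4 -> \sum_i W i ^+ 2 <= 1 ->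
  (\int[P]_t (expR (s * m%:R * distortion (a ^~ t) W))%:E
   <= (expR (4 * m%:R * s ^+ 2))%:E)%E.
Proof.
move=> s4; set v := \sum_i W i ^+ 2 => v1.
have v0 : 0 <= v by apply: sumr_ge0 => i _; exact: sqr_ge0.
have [sl su] : - (1/4) <= s /\ s <= 1 / 4 by apply/andP; rewrite -ler_norml.
have mp : 0 < m%:R :> R by rewrite ltr0n.
have sd0 : 0 < Num.sqrt (m%:R^-1) :> R by rewrite sqrtr_gt0 invr_gt0.
pose u (l : F * 'I_m) k := if l.2 == k then W l.1 else 0.
have sumu (g : F * 'I_m -> R) k (e : R -> R -> R) : (forall x, e 0 x = 0) ->
    \sum_(l in [set: F * 'I_m]%SET) e (u l k) (g l) = \sum_i e (W i) (g (i, k)).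
  move=> e0; transitivity (\sum_i \sum_(j < m) e (u (i, j) k) (g (i, j))).
    rewrite pair_bigA /=; apply: eq_big => l; first by rewrite inE.
    by case: l.
  apply: eq_bigr => i _; rewrite (bigD1 k) //= /u /= eqxx big1 ?addr0 //.
  by move=> j /negbTE ->.
have Vv k : \sum_(l in [set: F * 'I_m]%SET) u l k ^+ 2 = v.
  by rewrite (sumu (fun=> 0) k (fun x _ => x ^+ 2)) // => _; rewrite expr0n.
have sdE : (Num.sqrt m%:R^-1) ^+ 2 = m%:R^-1 :> R.
  by rewrite sqr_sqrtr // invr_ge0 ltW.
have hc (k : 'I_m) : 2 * (s * m%:R) * (Num.sqrt m%:R^-1) ^+ 2 *
    \sum_(l in [set: F * 'I_m]%SET) u l k ^+ 2 = 2 * s * v.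
  by rewrite Vv sdE; field; rewrite gt_eqF.
have sv2 : 2 * s * v <= 1 / 2 by nra.
pose g (t : T) := expR (\sum_k (s * m%:R) * (\sum_(l in [set: F * 'I_m]%SET) u l k * a l t) ^+ 2).
have gE (t : T) : expR (s * m%:R * distortion (a ^~ t) W) =
    expR (- (s * m%:R * v)) * g t.
  rewrite -expRD; congr expR; rewrite /distortion mulrBr addrC; congr (_ + _).
  rewrite mulr_sumr; apply: eq_bigr => k _; congr (_ * _ ^+ 2).
  rewrite (sumu (a ^~ t) k (fun x y => x * y)); last by move=> x; rewrite mul0r.
  by apply: eq_bigr => i _; rewrite mulrC.
under eq_integral do rewrite gE EFinM.
have mg : measurable_fun setT (fun t => (g t)%:E).
  apply/measurable_EFinP; apply: measurableT_comp => //.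
  apply: measurable_sum => k; apply: measurable_funM => //.
  apply: measurable_funX; under eq_fun do rewrite big_mkcond /=.
  by apply: measurable_sum => l; rewrite inE; exact: measurable_funM.
rewrite ge0_integralZl //; last by move=> t _; rewrite lee_fin expR_ge0.
rewrite (expectation_exp_quadratic sd0 indep_a norm_a (row := snd)
  (w := fun l => W l.1)); last first.
  by move=> k; have := hc k; rewrite /u => ->; lra.
rewrite -EFinM lee_fin.
under eq_bigr => k _ do rewrite [X in 1 - X](hc k).
rewrite prodr_const card_ord.
apply: (@le_trans _ _ (expR (- (s * m%:R * v)) *
    (expR (2 * s * v / 2 + (2 * s * v) ^+ 2)) ^+ m)).
  rewrite ler_wpM2l ?expR_ge0 // lerXn2r ?nnegrE ?expR_ge0 ?invr_ge0 ?sqrtr_ge0 //.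
  exact: invr_sqrt_le_expR.
rewrite -expRM_natl -expRD ler_expR.
have : s ^+ 2 * v ^+ 2 <= s ^+ 2 by rewrite ler_piMr ?sqr_ge0 // expr_le1.
move=> /(ler_wpM2l (ltW mp)) h.
nra.
Qed.

End distortion_mgf.

(** * Counting cells of a Euclidean ball *)

(** The difference of the two sides is half of the sum of the squares of the
[x i * y j - x j * y i] (Lagrange's identity). *)
Lemma cauchy_schwarz_sum {R : realType} {I : finType} (x y : I -> R) :
  (\sum_i x i * y i) ^+ 2 <= (\sum_i x i ^+ 2) * (\sum_i y i ^+ 2).
Proof.
rewrite -subr_ge0.
suff -> : (\sum_i x i ^+ 2) * (\sum_i y i ^+ 2) - (\sum_i x i * y i) ^+ 2
    = 2^-1 * \sum_i \sum_j (x i * y j - x j * y i) ^+ 2.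
  rewrite mulr_ge0 // ?invr_ge0 //; apply: sumr_ge0 => i _.
  by apply: sumr_ge0 => j _; exact: sqr_ge0.
have E (f g : I -> R) : (\sum_i f i) * (\sum_i g i) = \sum_i \sum_j f i * g j.
  by rewrite mulr_suml; apply: eq_bigr => i _; rewrite mulr_sumr.
apply: (@mulfI _ 2) => //; rewrite mulrA divff // mul1r.
rewrite expr2 !E mulrBr -[X in _ - X]mulrC.
have -> : 2 * \sum_i \sum_j x i ^+ 2 * y j ^+ 2 =
    \sum_i \sum_j (x i ^+ 2 * y j ^+ 2 + x j ^+ 2 * y i ^+ 2).
  under [RHS]eq_bigr do rewrite big_split /=.
  by rewrite big_split /= [X in _ + X]exchange_big /= mulr_natl mulr2n.
rewrite mulr_suml -sumrB; apply: eq_bigr => i _.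
rewrite mulr_suml -sumrB; apply: eq_bigr => j _.
by ring.
Qed.

Lemma geometric_sum_le {R : realType} (y : R) n : 0 <= y < 1 ->
  \sum_(j < n) y ^+ j <= (1 - y)^-1.
Proof.
move=> /andP[y0 y1]; rewrite -div1r ler_pdivlMr ?subr_gt0 //.
rewrite mulrC -opprB mulNr -subrX1 opprB lerBlDr lerDl.
by rewrite exprn_ge0.
Qed.

Lemma expR1_le4 {R : realType} : expR 1 <= 4 :> R.
Proof.
have h : expR (2^-1) <= 2 :> R.
  rewrite -[leRHS]invrK -[leLHS]invrK lef_pV2 ?posrE ?invr_gt0 ?expR_gt0 //.
  by rewrite -expRN; apply: le_trans (expR_ge1Dx _); lra.
have -> : expR 1 = expR (2^-1) * expR (2^-1) :> R by rewrite -expRD; congr expR; lra.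
rewrite (_ : 4 = 2 * 2 :> R); last by lra.
by rewrite ler_pM ?expR_ge0.
Qed.

(** Generating function bound: each [f] of the set contributes at least [y ^+ B]
to the sum over all functions of the product of the [y ^+ (f i).2], and this
sum factors into geometric series.  The choice [y = A / (A + 1)] balances the
factor [(2 / (1 - y)) ^+ #|I|] against the factor [y ^- B], which is then at
most [expR #|I|%:R]. *)
Lemma card_bounded_sum_le {R : realType} (I : finType) (B : nat) (A : R) :
  1 <= A -> B%:R <= #|I|%:R * A ->
  #|[set f : {ffun I -> bool * 'I_B.+1} | (\sum_i (f i).2 <= B)%N]%SET|%:R
    <= (16 * A) ^+ #|I|.
Proof.
move=> A1 BA; set C := [set f | _]%SET.
have A0 : 0 < A by lra.
pose y := A / (A + 1).
have y0 : 0 < y by rewrite divr_gt0 //; lra.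
have y1 : y < 1 by rewrite ltr_pdivrMr; lra.
have yE : (1 - y)^-1 = A + 1 by rewrite /y; field; lra.
have step : #|C|%:R * y ^+ B <=
    \sum_(f : {ffun I -> bool * 'I_B.+1}) \prod_i y ^+ (f i).2.
  rewrite -sum1_card natr_sum mulr_suml big_mkcond /=; apply: ler_sum => f _.
  case: ifPn => [|_]; last by apply: prodr_ge0 => i _; rewrite exprn_ge0 // ltW.
  rewrite inE mul1r -expr_sum => fB.
  by rewrite ler_wiXn2l // ltW.
have e1 : \sum_(f : {ffun I -> bool * 'I_B.+1}) \prod_i y ^+ (f i).2 <=
    (2 * (A + 1)) ^+ #|I|.
  rewrite -(bigA_distr_bigA (fun i (c : bool * 'I_B.+1) => y ^+ c.2)) /=.
  rewrite prodr_const; apply: lerXn2r; rewrite ?nnegrE.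
  - by apply: sumr_ge0 => c _; rewrite exprn_ge0 // ltW.
  - by rewrite mulr_ge0 //; lra.
  rewrite -(pair_bigA _ (fun (b : bool) (j : 'I_B.+1) => y ^+ j)) /=.
  rewrite big_bool /= mulr_natl mulr2n -yE.
  by rewrite lerD // geometric_sum_le // ltW.
have e2 : (y ^+ B)^-1 <= 4 ^+ #|I|.
  rewrite -exprVn (_ : y^-1 = 1 + A^-1); last by rewrite /y; field; lra.
  apply: (@le_trans _ _ (expR (A^-1) ^+ B)).
    rewrite lerXn2r ?nnegrE ?expR_ge0 ?expR_ge1Dx // addr_ge0 // invr_ge0 ltW //.
  rewrite -expRM_natl; apply: (@le_trans _ _ (expR #|I|%:R)).
    by rewrite ler_expR ler_pdivrMr.
  rewrite -[X in expR X]mulr1 expRM_natl.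
  by rewrite lerXn2r ?nnegrE ?expR_ge0 // expR1_le4.
have yB : 0 < y ^+ B by rewrite exprn_gt0.
rewrite -ler_pdivlMr // in step.
apply: (le_trans step); apply: (@le_trans _ _ ((2 * (A + 1)) ^+ #|I| * 4 ^+ #|I|)).
  rewrite ler_pM ?invr_ge0 ?(ltW yB) //; apply: sumr_ge0 => f _.
  by apply: prodr_ge0 => i _; rewrite exprn_ge0 // ltW.
rewrite -exprMn lerXn2r ?nnegrE //; lra.
Qed.

Lemma sum_norm_le {R : realType} {I : finType} (x : I -> R) (rad : R) :
  0 <= rad -> \sum_i x i ^+ 2 <= rad ^+ 2 ->
  \sum_i `|x i| <= Num.sqrt #|I|%:R * rad.
Proof.
move=> r0 xr.
rewrite -(ler_pXn2r (n := 2)) ?nnegrE //; last 2 first.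
- exact: sumr_ge0.
- by rewrite mulr_ge0 ?sqrtr_ge0.
rewrite exprMn sqr_sqrtr //.
have := cauchy_schwarz_sum (fun=> 1) (fun i => `|x i|).
under eq_bigr do rewrite mul1r.
move=> /le_trans; apply; rewrite expr1n sumr_const ler_wpM2l //.
by apply: le_trans xr; apply: ler_sum => i _; rewrite real_normK ?num_real.
Qed.

(** The cells are cubes of side [eta / Num.sqrt N], described by the signs and
the truncated magnitudes of the coordinates.  By Cauchy-Schwarz the magnitudes
of a point of the ball add up to at most [N * A], so [card_bounded_sum_le]
counts the cells that meet the ball.  Bounding each coordinate separately
instead would cost a factor [N ^ (N / 2)], hence a logarithm of the dimension
in the entropy. *)
Lemma euclidean_cells {R : realType} (I : finType) (A eta : R) :
  (0 < #|I|)%N -> 1 <= A -> 0 < eta ->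
  exists (K : finType) (cell : {ffun I -> R} -> K) (C : {set K}),
    [/\ #|C|%:R <= (16 * A) ^+ #|I|,
        (forall x : {ffun I -> R}, \sum_i x i ^+ 2 <= (A * eta) ^+ 2 -> cell x \in C) &
        (forall x y : {ffun I -> R}, \sum_i x i ^+ 2 <= (A * eta) ^+ 2 ->
           \sum_i y i ^+ 2 <= (A * eta) ^+ 2 -> cell x = cell y ->
           \sum_i (x i - y i) ^+ 2 <= eta ^+ 2)].
Proof.
move=> I0 A1 eta0; set N : R := #|I|%:R.
have N0 : 0 < N by rewrite ltr0n.
have A0 : 0 < A by lra.
have sN0 : 0 < Num.sqrt N by rewrite sqrtr_gt0.
pose B := Num.truncn (N * A).
pose scale := Num.sqrt N / eta.
have scale0 : 0 < scale by rewrite divr_gt0.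
pose mag (x : {ffun I -> R}) i := Num.truncn (`|x i| * scale).
have mag_le (x : {ffun I -> R}) i : (mag x i)%:R <= `|x i| * scale.
  by rewrite truncn_le // mulr_ge0 // ltW.
have mag_lt (x : {ffun I -> R}) i : `|x i| * scale < (mag x i)%:R + 1.
  by rewrite natr1 truncnS_gt.
pose cell (x : {ffun I -> R}) : {ffun I -> bool * 'I_B.+1} :=
  [ffun i => (x i < 0, inord (mag x i))].
exists {ffun I -> bool * 'I_B.+1}, cell.
pose C := [set f : {ffun I -> bool * 'I_B.+1} | (\sum_i (f i).2 <= B)%N]%SET.
have sum_mag (x : {ffun I -> R}) : \sum_i x i ^+ 2 <= (A * eta) ^+ 2 -> (\sum_i mag x i <= B)%N.
  move=> xA; rewrite truncn_ge_nat ?mulr_ge0 ?(ltW N0) ?(ltW A0) // natr_sum.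
  apply: (@le_trans _ _ (\sum_i `|x i| * scale)); first exact: ler_sum.
  rewrite -mulr_suml; apply: (@le_trans _ _ (Num.sqrt N * (A * eta) * scale)).
    by rewrite ler_wpM2r ?(ltW scale0) // sum_norm_le // mulr_ge0 // ltW.
  rewrite /scale -[in leRHS](sqr_sqrtr (ltW N0)) le_eqVlt; apply/orP; left.
  by apply/eqP; field; rewrite gt_eqF.
have mag_small (x : {ffun I -> R}) i : \sum_i x i ^+ 2 <= (A * eta) ^+ 2 -> (mag x i < B.+1)%N.
  by move=> /sum_mag; rewrite ltnS; apply: leq_trans; rewrite (bigD1 i) //= leq_addr.
exists C; split.
- by apply: card_bounded_sum_le => //; rewrite truncn_le mulr_ge0 // ltW.
- move=> x xA; rewrite inE; apply: leq_trans (sum_mag x xA).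
  by apply: leq_sum => i _; rewrite ffunE /= inordK // mag_small.
- move=> x y xA yA /ffunP xy.
  have close i : `|x i - y i| <= scale^-1.
    have := xy i; rewrite !ffunE => -[sgn /(congr1 (@nat_of_ord _))].
    rewrite !inordK ?mag_small // => magE.
    have := mag_lt x i; have := mag_lt y i; have := mag_le x i; have := mag_le y i.
    rewrite magE -[scale^-1]div1r ler_pdivlMr // -{5}(gtr0_norm scale0) -normrM => a b c e.
    have h : `| `|x i| * scale - `|y i| * scale | <= 1 by rewrite ler_norml; lra.
    apply: le_trans h.
    move: sgn; have [x0|x0] := ltP (x i) 0; have [y0|y0] := ltP (y i) 0 => // _.
      by rewrite (ltr0_norm x0) (ltr0_norm y0) !mulNr -opprD normrN mulrBl.
    by rewrite (ger0_norm x0) (ger0_norm y0) mulrBl.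
  apply: (@le_trans _ _ (\sum_(i : I) (scale^-1) ^+ 2)).
    apply: ler_sum => i _; rewrite -[leLHS]real_normK ?num_real //.
    by rewrite lerXn2r ?nnegrE // invr_ge0 ltW.
  rewrite sumr_const /scale invf_div expr_div_n (sqr_sqrtr (ltW N0)).
  by rewrite -mulr_natr divfK // gt_eqF.
Qed.

(** * Norms of tensors and outer products *)

Section l2norm_theory.
Context {R : realType} {I : finType}.
Implicit Types f g : I -> R.

Lemma l2norm_ge0 f : 0 <= l2norm f.
Proof. exact: sqrtr_ge0. Qed.

Lemma sqr_l2norm f : l2norm f ^+ 2 = \sum_i f i ^+ 2.
Proof. by rewrite sqr_sqrtr // sumr_ge0 // => i _; exact: sqr_ge0. Qed.

Lemma l2norm_triangle f g : l2norm (fun i => f i + g i) <= l2norm f + l2norm g.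
Proof.
rewrite -(ler_pXn2r (n := 2)) ?nnegrE ?addr_ge0 ?l2norm_ge0 //.
rewrite sqrrD !sqr_l2norm.
have fg : \sum_i f i * g i <= l2norm f * l2norm g.
  have := cauchy_schwarz_sum f g; rewrite -!sqr_l2norm -exprMn.
  by rewrite -[X in X <= _]real_normK ?num_real // ler_pXn2r ?nnegrE ?mulr_ge0
    ?l2norm_ge0 // => /(le_trans (ler_norm _)).
under eq_bigr do rewrite sqrrD.
rewrite !big_split /= lerD2r lerD2l.
by rewrite mulr2n lerD.
Qed.

Lemma l2normZ c f : l2norm (fun i => c * f i) = `|c| * l2norm f.
Proof.
rewrite /l2norm; under eq_bigr do rewrite exprMn.
by rewrite -mulr_sumr sqrtrM ?sqr_ge0 // sqrtr_sqr.
Qed.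

End l2norm_theory.

Lemma ler_frobenius_sum {R : realType} (d : nat) (n : 'I_d -> nat) (J : Type)
    (s : seq J) (Q : pred J) (X : J -> tensor R n) :
  frobenius (\sum_(j <- s | Q j) X j) <= \sum_(j <- s | Q j) frobenius (X j).
Proof.
elim/big_ind2: _ => // [|x Y z Z xY zZ].
  rewrite /frobenius /l2norm big1 ?sqrtr0 // => i _.
  by rewrite ffunE expr0n.
apply: le_trans (lerD xY zZ).
rewrite /frobenius; apply: le_trans (l2norm_triangle _ _).
by rewrite /l2norm; under eq_bigr do rewrite ffunE.
Qed.

(** Distributivity for dependent families, whose factors are sums over
different index types. *)
Lemma sum_midx_prod {R : comNzRingType} (d : nat) (n : 'I_d -> nat)
    (g : forall j : 'I_d, 'I_(n j) -> R) :
  \sum_(i : midx n) \prod_j g j (i j) = \prod_j \sum_t g j t.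
Proof.
pose T_ (j : 'I_d) : finType := 'I_(n j).
pose p j : {ffun T_ j -> R} := [ffun t => g j t].
transitivity (\sum_(t : fprod T_) \prod_j p j (t j)).
  rewrite (reindex (@dffun_of_fprod _ T_)) /=; last first.
    exact/onW_bij/dffun_of_fprod_bij.
  by apply: eq_bigr => t _; apply: eq_bigr => j _; rewrite !ffunE.
have -> : \prod_j \sum_t g j t =
    \prod_j \sum_(u in tagged_with T_ j) untag 0 (p j) u.
  apply: eq_bigr => j _; rewrite -(big_tag (T_ := T_) (fun j t => p j t)).
  by apply: eq_bigr => t _; rewrite ffunE.
rewrite bigA_distr_big_dep (big_fprod_dep _ _ p predT).
by apply: eq_bigl => f; rewrite andbT.
Qed.

Lemma frobenius_outer {R : realType} (d : nat) (n : 'I_d -> nat)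
    (x : forall j : 'I_d, 'rV[R]_(n j)) :
  frobenius (outer x) = \prod_j norm2 (x j).
Proof.
apply: (@pexpIrn _ 2) => //; rewrite ?nnegrE ?l2norm_ge0 //.
  by apply: prodr_ge0 => j _; exact: l2norm_ge0.
rewrite -prodrXl sqr_l2norm; under [RHS]eq_bigr do rewrite sqr_l2norm.
rewrite -(sum_midx_prod (fun j t => x j ord0 t ^+ 2)).
by apply: eq_bigr => i _; rewrite ffunE prodrXl.
Qed.

(** Replace the factors of [x] by those of [y] one at a time; each replacement
changes the outer product by an outer product that has one factor
[x k - y k]. *)
Lemma frobenius_outerB_le {R : realType} (d : nat) (n : 'I_d -> nat)
    (x y : forall j : 'I_d, 'rV[R]_(n j)) (rho : R) :
  (forall j, norm2 (x j) <= rho) -> (forall j, norm2 (y j) <= rho) ->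
  frobenius (outer x - outer y) <= rho ^+ d.-1 * \sum_j norm2 (x j - y j).
Proof.
move=> xr yr.
pose h k (j : 'I_d) := if (j < k)%N then y j else x j.
have hr k j : norm2 (h k j) <= rho by rewrite /h; case: ifP.
have -> : outer x - outer y = \sum_(k < d) (outer (h k) - outer (h k.+1)).
  rewrite -(big_mkord predT (fun k => outer (h k) - outer (h k.+1))).
  rewrite -[RHS]opprK -sumrN; under eq_bigr do rewrite opprB.
  rewrite telescope_sumr // opprB; congr (_ - _).
  by apply/ffunP => i; rewrite !ffunE; apply: eq_bigr => j _; rewrite /h ltn_ord.
apply: le_trans (ler_frobenius_sum _ _ _) _.
rewrite mulr_sumr; apply: ler_sum => k _.
pose z (j : 'I_d) := if j == k then x j - y j else h k j.
have -> : outer (h k) - outer (h k.+1) = outer z.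
  apply/ffunP => i; rewrite !ffunE.
  rewrite (bigD1 k) //= [in X in _ - X](bigD1 k) //= [RHS](bigD1 k) //=.
  rewrite /z eqxx /h ltnn ltnSn !mxE mulrBl; congr (_ * _ - _ * _).
    by apply: eq_bigr => j /negbTE ->.
  by apply: eq_bigr => j jk; rewrite (negbTE jk) ltnS leq_eqVlt (inj_eq val_inj) (negbTE jk).
rewrite frobenius_outer (bigD1 k) //= /z eqxx mulrC ler_wpM2r ?l2norm_ge0 //.
have rho0 : 0 <= rho by apply: le_trans (xr k); exact: l2norm_ge0.
apply: (@le_trans _ _ (\prod_(j < d | j != k) rho)).
  apply: ler_prod => j /negbTE jk; rewrite jk hr andbT; exact: l2norm_ge0.
by rewrite prodr_const cardC1 card_ord.
Qed.

(** * Nets of tensors of bounded CP rank *)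

Section cp_parametrization.
Context {R : realType} {d : nat} {n : 'I_d -> nat} {r : nat}.

Definition cp_index : finType := ('I_r * {j : 'I_d & 'I_(n j)})%type.

Definition cp_entry (i : 'I_r) (j : 'I_d) (t : 'I_(n j)) : cp_index :=
  (i, existT (fun j => 'I_(n j)) j t).

Definition cp_factor (theta : {ffun cp_index -> R}) (i : 'I_r) (j : 'I_d) :
  'rV[R]_(n j) := \row_t theta (cp_entry i t).

Definition cp_tensor (theta : {ffun cp_index -> R}) : tensor R n :=
  \sum_i outer (cp_factor theta i).

Lemma card_cp_index : #|cp_index| = (r * \sum_j n j)%N.
Proof.
rewrite card_prod card_ord card_tagged sumnE big_map big_enum /=.
by congr (_ * _)%N; apply: eq_bigr => j _; rewrite card_ord.
Qed.

Lemma sum_cp_index (f : cp_index -> R) :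
  \sum_l f l = \sum_i \sum_j \sum_(t < n j) f (cp_entry i t).
Proof.
have -> : \sum_l f l = \sum_(l : cp_index) f (l.1, l.2).
  by apply: eq_bigr => -[].
rewrite -(pair_bigA _ (fun i u => f (i, u))) /=.
apply: eq_bigr => i _.
rewrite (@sig_big_dep _ _ _ 'I_d (fun j => 'I_(n j)) xpredT
  (fun _ _ => true) (fun j (t : 'I_(n j)) => f (cp_entry i t))) /=.
by apply: eq_bigr => -[].
Qed.

Lemma sum_sqr_cp (theta : {ffun cp_index -> R}) :
  \sum_l theta l ^+ 2 = \sum_i \sum_j norm2 (cp_factor theta i j) ^+ 2.
Proof.
rewrite sum_cp_index; apply: eq_bigr => i _; apply: eq_bigr => j _.
by rewrite sqr_l2norm; apply: eq_bigr => t _; rewrite mxE.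
Qed.

Lemma cp_tensor_lipschitz (theta theta' : {ffun cp_index -> R}) (rho eta : R) :
  0 <= rho -> 0 <= eta ->
  (forall i j, norm2 (cp_factor theta i j) <= rho) ->
  (forall i j, norm2 (cp_factor theta' i j) <= rho) ->
  \sum_l (theta l - theta' l) ^+ 2 <= eta ^+ 2 ->
  frobenius (cp_tensor theta - cp_tensor theta')
    <= rho ^+ d.-1 * (Num.sqrt (r * d)%:R * eta).
Proof.
move=> rho0 eta0 h h' close.
pose g (p : 'I_r * 'I_d) := norm2 (cp_factor theta p.1 p.2 - cp_factor theta' p.1 p.2).
have g0 p : 0 <= g p by exact: l2norm_ge0.
rewrite /cp_tensor -sumrB; apply: le_trans (ler_frobenius_sum _ _ _) _.
apply: (@le_trans _ _ (rho ^+ d.-1 * \sum_p g p)).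
  rewrite -(pair_bigA _ (fun i j => g (i, j))) mulr_sumr.
  by apply: ler_sum => i _; exact: frobenius_outerB_le.
rewrite ler_wpM2l ?exprn_ge0 //.
have -> : (r * d)%N = #|{: 'I_r * 'I_d}| by rewrite card_prod !card_ord.
under eq_bigr => p _ do rewrite -(ger0_norm (g0 p)).
apply: sum_norm_le => //; apply: le_trans close; rewrite le_eqVlt; apply/orP; left.
rewrite sum_cp_index -(pair_bigA _ (fun i j => g (i, j) ^+ 2)); apply/eqP.
apply: eq_bigr => i _; apply: eq_bigr => j _.
by rewrite sqr_l2norm; apply: eq_bigr => t _; rewrite !mxE.
Qed.

Lemma bounded_cp_set_param (rho : R) X : bounded_cp_set r rho X ->
  exists2 theta, X = cp_tensor theta &
    forall i j, norm2 (cp_factor theta i j) <= rho.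
Proof.
move=> [_ [x [-> xr]]].
exists [ffun l : cp_index => x l.1 (tag l.2) ord0 (tagged l.2)].
  apply: eq_bigr => i _; apply/ffunP => k; rewrite !ffunE.
  by apply: eq_bigr => j _; rewrite !mxE !ffunE.
move=> i j; apply: le_trans (xr i j); rewrite /norm2 /l2norm.
by under eq_bigr do rewrite !mxE !ffunE.
Qed.

(** Each outer product has norm at most [rho ^+ d], and the sum has norm 1. *)
Lemma bounded_cp_set_size (rho : R) (X : tensor R n) : bounded_cp_set r rho X ->
  1 <= r%:R * rho ^+ d.
Proof.
move=> [X1 [x [XE xr]]]; rewrite -[leLHS]X1 XE; apply: le_trans (ler_frobenius_sum _ _ _) _.
apply: (@le_trans _ _ (\sum_(i < r) rho ^+ d)); last first.
  by rewrite sumr_const card_ord mulr_natl.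
apply: ler_sum => i _; rewrite frobenius_outer.
apply: (@le_trans _ _ (\prod_(j < d) rho)).
  by apply: ler_prod => j _; rewrite l2norm_ge0 xr.
by rewrite prodr_const card_ord.
Qed.

(** Pull the cells of the parameter ball back to the set: for each cell that
contains the parameter of some element, keep one such element.  In this way
the net lies inside the set. *)
Lemma bounded_cp_net (rho e : R) :
  (0 < d)%N -> (0 < \sum_j n j)%N -> (0 < r)%N -> 0 < rho -> 0 < e <= 1 ->
  bounded_cp_set (n := n) r rho !=set0 ->
  exists s : seq (tensor R n),
    [/\ (size s)%:R <= (16 * (d%:R * r%:R * rho ^+ d / e)) ^+ (r * \sum_j n j),
        (forall X, X \in s -> bounded_cp_set r rho X) &
        (forall X, bounded_cp_set r rho X ->
           exists2 Y, Y \in s & frobenius (X - Y) <= e)].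
Proof.
move=> d0 n0 r0 rho0 /andP[e0 e1] [X0 SX0].
set A := d%:R * r%:R * rho ^+ d / e.
have rho1 := bounded_cp_set_size SX0.
have d1 : 1 <= d%:R :> R by rewrite ler1n.
have A1 : 1 <= A.
  rewrite ler_pdivlMr // mul1r (le_trans e1) // -mulrA.
  by rewrite (le_trans rho1) // ler_peMl // (le_trans ler01).
have rd0 : 0 < (r * d)%:R :> R by rewrite ltr0n muln_gt0 r0 d0.
pose q : R := Num.sqrt (r * d)%:R.
have q0 : 0 < q by rewrite sqrtr_gt0.
have q2 : q ^+ 2 = (r * d)%:R by rewrite sqr_sqrtr // ltW.
(* The resolution in parameter space that the Lipschitz constant turns into
   [e]. *)
pose eta := e / (rho ^+ d.-1 * q).
have p0 : 0 < rho ^+ d.-1 by rewrite exprn_gt0.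
have eta0 : 0 < eta by rewrite divr_gt0 // mulr_gt0.
have AetaE : A * eta = rho * q.
  have -> : A = q ^+ 2 * (rho * rho ^+ d.-1) / e.
    by rewrite /A q2 -exprS prednK // mulnC natrM.
  by rewrite /eta; field; rewrite !gt_eqF.
have I0 : (0 < #|cp_index|)%N by rewrite card_cp_index muln_gt0 r0.
have [K [cell [C [cardC inC sameC]]]] := euclidean_cells I0 A1 eta0.
have ball (theta : {ffun cp_index -> R}) : (forall i j, norm2 (cp_factor theta i j) <= rho) ->
    \sum_l theta l ^+ 2 <= (A * eta) ^+ 2.
  move=> h; rewrite sum_sqr_cp AetaE exprMn q2.
  apply: (@le_trans _ _ (\sum_(i < r) \sum_(j < d) rho ^+ 2)).
    apply: ler_sum => i _; apply: ler_sum => j _.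
    by rewrite lerXn2r ?nnegrE ?l2norm_ge0 // ltW.
  by rewrite !sumr_const !card_ord -mulrnA mulnC mulr_natr.
pose good c (theta : {ffun cp_index -> R}) :=
  [/\ cell theta = c, bounded_cp_set r rho (cp_tensor theta) &
    forall i j, norm2 (cp_factor theta i j) <= rho].
pose rep c : tensor R n :=
  if pselect (exists theta, good c theta) is left h then cp_tensor (projT1 (cid h))
  else X0.
exists [seq rep c | c <- enum C]; split.
- by rewrite size_map -cardE -card_cp_index.
- move=> X /mapP[c _ ->]; rewrite /rep; case: pselect => // h.
  by case: cid => theta [].
- move=> X SX; have [theta XE h] := bounded_cp_set_param SX.
  exists (rep (cell theta)).
    by apply/mapP; exists (cell theta) => //; rewrite mem_enum inC // ball.
  rewrite /rep; case: pselect => [g|[]]; last by exists theta; split => //; rewrite -XE.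
  case: cid => theta' /= [cE _ h'].
  rewrite XE; apply: le_trans (cp_tensor_lipschitz (ltW rho0) (ltW eta0) h h' _) _.
    by apply: sameC => //; exact: ball.
  by rewrite -/q mulrA /eta mulrCA divff ?mulr1 // gt_eqF // mulr_gt0.
Qed.

End cp_parametrization.

(** The nets at all resolutions, with their entropy expressed through [K].  As
[Lam >= 2], the bound [16 * Lam * 2 ^+ k] is at most [Lam ^+ (5 + k)].  The
chain starts at level 0 from the single point [0], which is within distance 1
of all unit tensors but is not one of them. *)
Lemma bounded_cp_nets {R : realType} (d : nat) (n : 'I_d -> nat) (r : nat) (rho : R) :
  (2 <= d)%N -> (forall j : 'I_d, (0 < n j)%N) -> (0 < r)%N -> 0 < rho ->
  bounded_cp_set (n := n) r rho !=set0 ->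
  let K := r%:R * ln (d%:R * r%:R * rho ^+ d) * \sum_(j < d) (n j)%:R in
  1 <= K /\
  exists s : nat -> seq (tensor R n),
    [/\ s 0%N = [:: 0],
        forall k X, X \in s k.+1 -> bounded_cp_set r rho X,
        forall k X, bounded_cp_set r rho X ->
           exists2 Y, Y \in s k & frobenius (X - Y) <= 2^-1 ^+ k &
        forall k, (size (s k))%:R <= expR ((5 + k%:R) * K)].
Proof.
move=> d2 n0 r0 rho0 SX K; have [X0 SX0] := SX.
set Lam := d%:R * r%:R * rho ^+ d in K *.
have Lam2 : 2 <= Lam.
  rewrite /Lam -mulrA -[leLHS]mulr1; apply: ler_pM => //.
    by rewrite ler_nat.
  exact: bounded_cp_set_size SX0.
have Lam0 : 0 < Lam by lra.
have dn : (d <= \sum_j n j)%N.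
  by rewrite -[leqLHS]card_ord -sum1_card; apply: leq_sum => j _; exact: n0.
pose N := (r * \sum_j n j)%N.
have N2 : (2 <= N)%N.
  by rewrite (leq_trans d2) // (leq_trans dn) // leq_pmull.
have KE : K = N%:R * ln Lam by rewrite /K natrM natr_sum mulrAC.
have lnL : 1 <= 2 * ln Lam.
  rewrite mulr_natl -lnXn // -[leLHS]expRK ler_ln ?posrE ?expR_gt0 ?exprn_gt0 //.
  by apply: le_trans expR1_le4 _; rewrite (_ : 4 = 2 ^+ 2) ?lerXn2r ?nnegrE //; lra.
have K1 : 1 <= K.
  rewrite KE; apply: le_trans lnL _; rewrite ler_wpM2r ?ler_nat // ln_ge0 //; lra.
split=> //.
have /choice[s hs] : forall k, exists s : seq (tensor R n),
    [/\ (size s)%:R <= (16 * (Lam / 2^-1 ^+ k)) ^+ N,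
        (forall X, X \in s -> bounded_cp_set r rho X) &
        (forall X, bounded_cp_set r rho X ->
           exists2 Y, Y \in s & frobenius (X - Y) <= 2^-1 ^+ k)].
  move=> k; apply: bounded_cp_net => //.
  - exact: ltnW.
  - exact: leq_trans (ltnW d2) dn.
  - by rewrite exprn_gt0 ?invr_gt0 //= exprn_ile1 ?invr_ge0 // invf_le1 // ler1n.
exists (fun k => if k is 0%N then [:: 0] else s k); split => //.
- by move=> k X; have [_ + _] := hs k.+1; apply.
- move=> [|k] X SX'; last by have [_ _] := hs k.+1; apply.
  by exists 0; rewrite ?inE // subr0 expr0; have [->] := SX'.
- move=> [|k] /=.
    by rewrite -[leLHS]expR0 ler_expR mulr_ge0 //; lra.
  have [sz _ _] := hs k.+1; apply: le_trans sz _.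
  have -> : expR ((5 + k.+1%:R) * K) = (Lam ^+ (5 + k.+1)) ^+ N.
    rewrite KE -exprM -[in RHS](lnK (x := Lam)) ?posrE // -expRM_natl; congr expR.
    by rewrite natrM natrD; ring.
  rewrite lerXn2r ?nnegrE ?exprn_ge0 ?(ltW Lam0) //.
    by rewrite mulr_ge0 // divr_ge0 ?(ltW Lam0) // exprn_ge0 // invr_ge0.
  rewrite exprVn invrK mulrCA exprD [Lam ^+ 5]exprS -mulrA ler_wpM2l ?(ltW Lam0) //.
  apply: ler_pM => //; rewrite ?exprn_ge0 //.
  - rewrite (_ : 16 = 2 ^+ 4) ?lerXn2r ?nnegrE //; lra.
  - by rewrite lerXn2r ?nnegrE //; lra.
Qed.

(** * Chaining *)

Section chaining.
Context {R : realType} {F : finType} {m : nat}.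
Implicit Types x y W : {ffun F -> R}.

(** The polarization vectors of [x] and [y]: the sum [x + y] has norm at most 2,
and [x - y] is rescaled to norm at most 1, so that division by 3 brings both
combinations into the unit ball. *)
Definition link (eta : R) (b : bool) x y : {ffun F -> R} :=
  [ffun i => ((x i + y i) + (-1) ^+ b * ((x i - y i) / eta)) / 3].

(** For a quadratic form, [q x - q y] is the value of its polar form at [x + y]
and [x - y]; rescaling [x - y] by [eta] brings out the factor [eta], the
length of the step. *)
Lemma distortion_link (a : F * 'I_m -> R) (eta : R) x y : eta != 0 ->
  distortion a x - distortion a y =
  9 * eta / 4 * (distortion a (link eta false x y) - distortion a (link eta true x y)).
Proof.
move=> eta0.
have Q (u v : R) : u ^+ 2 - v ^+ 2 = 9 * eta / 4 *
   ((((u + v) + (u - v) / eta) / 3) ^+ 2 - (((u + v) - (u - v) / eta) / 3) ^+ 2).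
  by field; rewrite eta0.
have S (p q p' q' : R) : p - q - (p' - q') = (p - p') - (q - q') by ring.
rewrite /distortion [LHS]S [X in _ * X]S mulrBr -!sumrB !mulr_sumr; congr (_ - _).
  apply: eq_bigr => k _; rewrite Q; congr (_ * (_ ^+ 2 - _ ^+ 2)).
    rewrite -sumrB -big_split /= !mulr_suml -big_split mulr_suml /=.
    by apply: eq_bigr => i _; rewrite !ffunE; field; rewrite eta0.
  rewrite -big_split -sumrB /= !mulr_suml -sumrB mulr_suml /=.
  by apply: eq_bigr => i _; rewrite !ffunE; field; rewrite eta0.
by apply: eq_bigr => i _; rewrite Q !ffunE expr0 expr1 mul1r mulN1r.
Qed.

Lemma link_le1 (eta : R) b x y : 0 < eta -> l2norm x <= 1 -> l2norm y <= 1 ->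
  l2norm (x - y) <= eta -> \sum_i link eta b x y i ^+ 2 <= 1.
Proof.
move=> eta0 x1 y1 xy; rewrite -sqr_l2norm expr_le1 ?l2norm_ge0 //.
pose f i : R := x i + y i; pose g i : R := (-1) ^+ b / eta * (x - y) i.
have -> : l2norm (link eta b x y) = l2norm (fun i => 3^-1 * (f i + g i)).
  rewrite /l2norm; congr Num.sqrt; apply: eq_bigr => i _.
  by rewrite /f /g !ffunE mulrC mulrA mulrAC.
rewrite l2normZ gtr0_norm ?invr_gt0 // ler_pdivrMl // mulr1.
have fl : l2norm f <= 2.
  by apply: le_trans (l2norm_triangle x y) _; lra.
have gl : l2norm g <= 1.
  rewrite l2normZ normrM normrX normrN1 expr1n mul1r normfV (gtr0_norm eta0).
  by rewrite ler_pdivrMl // mulr1.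
by apply: le_trans (l2norm_triangle f g) _; lra.
Qed.

(** Telescoping from a point of [s k] down to [0] through the coarser nets, with
the sum of [(j + 1) * 2^-j] over [j < k] equal to
[4 - (2 * k + 4) * 2^-k]. *)
Lemma chain_bound (q : {ffun F -> R} -> R) (s : nat -> seq {ffun F -> R}) (c : R) :
  0 <= c -> s 0%N = [:: 0] -> q 0 = 0 ->
  (forall k x, x \in s k.+1 -> exists2 y, y \in s k & l2norm (x - y) <= 2^-1 ^+ k) ->
  (forall k x y, x \in s k.+1 -> y \in s k -> l2norm (x - y) <= 2^-1 ^+ k ->
     `|q x - q y| <= c * (k.+1%:R * 2^-1 ^+ k)) ->
  forall k x, x \in s k -> `|q x| <= 4 * c.
Proof.
move=> c0 s0 q0 near step k x xs.
apply: (@le_trans _ _ (c * (4 - (2 * k%:R + 4) * 2^-1 ^+ k))); last first.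
  rewrite mulrC ler_wpM2r // gerBl mulr_ge0 ?exprn_ge0 // addr_ge0 // mulr_ge0 //.
elim: k x xs => [|k IHk] x xs.
  by move: xs; rewrite s0 inE => /eqP ->; rewrite q0 normr0 expr0 mulr0; lra.
have [y ys xy] := near k x xs.
have := step k x y xs ys xy; have := IHk y ys.
have := ler_normD (q x - q y) (q y); rewrite subrK exprS -natr1.
set p := 2^-1 ^+ k; set kk := k%:R.
move=> h1 h2 h3; nra.
Qed.

End chaining.

Section exponential_union_bound.
Context {R : realType} {disp : measure_display} {T : measurableType disp}.
Variables (P : probability T R) (F : finType) (m : nat).
Variables (a : F * 'I_m -> {RV P >-> R}).
Hypothesis m0 : (0 < m)%N.
Hypothesis indep_a : independent_RVs a.
Hypothesis norm_a : forall l, has_normal_law (a l) 0 (Num.sqrt m%:R^-1).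

(** A sum of exponentials that is at most 1 only if all the distortions of the
tensors in [l] are at most [thr] in absolute value.  Bounding its expectation
does the work of a union bound and of Chernoff's bound at once. *)
Definition exp_excess (s thr : R) (l : seq {ffun F -> R}) (t : T) : R :=
  \sum_(W <- l) (expR (s * m%:R * distortion (a ^~ t) W)
      + expR (- s * m%:R * distortion (a ^~ t) W)) * expR (- (s * m%:R * thr)).

Lemma exp_excess_ge0 s thr l t : 0 <= exp_excess s thr l t.
Proof. by apply: sumr_ge0 => W _; rewrite mulr_ge0 ?addr_ge0 ?expR_ge0. Qed.

Lemma measurable_exp_excess s thr l : measurable_fun setT (exp_excess s thr l).
Proof.
apply: measurable_sum => W; apply: measurable_funM => //.
by apply: measurable_funD; apply: measurableT_comp => //;
  apply: measurable_funM => //; exact: measurable_distortion.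
Qed.

Lemma exp_excess_le1 s thr (l : seq {ffun F -> R}) t W :
  0 < s -> W \in l -> exp_excess s thr l t <= 1 ->
  `|distortion (a ^~ t) W| <= thr.
Proof.
move=> s0 Wl; rewrite /exp_excess (perm_big _ (perm_to_rem Wl)) big_cons /= => h.
have sm : 0 < s * m%:R by rewrite mulr_gt0 // ltr0n.
have rest : 0 <= exp_excess s thr (rem W l) t by exact: exp_excess_ge0.
move: h; rewrite mulrDl -!expRD => h.
set q := distortion _ W in h *.
have h1 : s * m%:R * q + - (s * m%:R * thr) <= 0.
  by rewrite -ler_expR expR0; apply: le_trans h; rewrite -addrA lerDl addr_ge0 ?expR_ge0.
have h2 : - s * m%:R * q + - (s * m%:R * thr) <= 0.
  by rewrite -ler_expR expR0; apply: le_trans h; rewrite addrAC lerDr addr_ge0 ?expR_ge0.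
rewrite ler_norml -(ler_pM2l sm) -[X in _ && X](ler_pM2l sm).
by apply/andP; split; lra.
Qed.

Lemma expectation_exp_excess_le s thr (l : seq {ffun F -> R}) : 0 < s <= 1 / 4 ->
  (forall W : {ffun F -> R}, W \in l -> \sum_i W i ^+ 2 <= 1) ->
  (\int[P]_t (exp_excess s thr l t)%:E <=
   ((size l)%:R * (2 * expR (4 * m%:R * s ^+ 2 - s * m%:R * thr)))%:E)%E.
Proof.
move=> /andP[s0 s4] l1.
have me (c : R) W : measurable_fun setT
    (fun t => (expR (c * m%:R * distortion (a ^~ t) W))%:E).
  apply/measurable_EFinP; apply: measurableT_comp => //.
  by apply: measurable_funM => //; exact: measurable_distortion.
under eq_integral do rewrite -sumEFin.
rewrite ge0_integral_sum //; last first.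
  move=> W; apply/measurable_EFinP; apply: measurable_funM => //.
  by apply: measurable_funD; apply/measurable_EFinP; exact: me.
apply: (@le_trans _ _ (\sum_(W <- l)
    (2 * expR (4 * m%:R * s ^+ 2 - s * m%:R * thr))%:E)%E); last first.
  by rewrite sumEFin lee_fin big_const_seq count_predT iter_addr_0 -[leLHS]mulr_natl.
rewrite !big_seq; apply: lee_sum => W Wl.
under eq_integral do rewrite EFinM EFinD.
rewrite ge0_integralZr //; last 2 first.
- by apply: emeasurable_funD; exact: me.
- by move=> t _; rewrite adde_ge0 ?lee_fin ?expR_ge0.
rewrite ge0_integralD //.
rewrite expRD mulrA EFinM.
apply: lee_wpmul2r; first by rewrite lee_fin expR_ge0.
rewrite mulr_natl mulr2n EFinD; apply: leeD.
  apply: expectation_exp_distortion => //; last exact: l1.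
  by rewrite gtr0_norm.
rewrite -(sqrrN s); apply: expectation_exp_distortion => //; last exact: l1.
by rewrite normrN gtr0_norm.
Qed.

End exponential_union_bound.

Section borel_cantelli_bound.
Context {R : realType} {disp : measure_display} {T : measurableType disp}.
Variable P : probability T R.

(** Markov's inequality for each [f k], and a union bound over [k]. *)
Lemma probability_all_le1 (f : nat -> T -> R) (eps : R) :
  0 <= eps -> (forall k, measurable_fun setT (f k)) -> (forall k t, 0 <= f k t) ->
  (forall k, \int[P]_t (f k t)%:E <= (eps / (2 ^ k.+1)%:R)%:E)%E ->
  ((1 - eps)%:E <= P (\bigcap_k [set t | (f k t <= 1)%R]))%E.
Proof.
move=> eps0 mf f0 intf.
have mB k : measurable [set t | 1 < f k t].
  have -> : [set t | 1 < f k t] = setT `&` f k @^-1` [set` `]1, +oo[].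
    by apply/seteqP; split => t /=; rewrite in_itv /= andbT => // -[].
  exact: mf.
have -> : \bigcap_k [set t | f k t <= 1] = ~` (\bigcup_k [set t | 1 < f k t]).
  rewrite setC_bigcup; apply: eq_bigcapr => k _.
  by apply/seteqP; split => t /=; rewrite leNgt => /negP.
rewrite probability_setC; last exact: bigcup_measurable.
rewrite EFinB leeB // (le_trans (generalized_Boole_inequality _ _ _)) //.
  exact: bigcup_measurable.
apply: le_trans (epsilon_trick0 xpredT eps0).
apply: lee_nneseries => [k _ _|k _]; first exact: measure_ge0.
apply: le_trans (intf k).
have mfk : measurable_fun setT (EFin \o f k) by exact/measurable_EFinP.
have := le_integral_abse P measurableT mfk (ltr01 : 0 < 1 :> R).
rewrite mul1e setTI; under eq_integral do rewrite gee0_abs ?lee_fin //.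
apply: le_trans; apply: le_measure; rewrite ?inE //.
  rewrite -[X in measurable X]setTI.
  have -> : [set x | (1%:E <= `|(EFin \o f k) x|)%E] = f k @^-1` [set` `[1, +oo[].
    by apply/seteqP; split => t /=; rewrite in_itv /= andbT ger0_norm ?lee_fin.
  exact: mf.
by move=> t /= ft; rewrite lee_fin ger0_norm // ltW.
Qed.

End borel_cantelli_bound.

Section chaining_probability.
Context {R : realType} {disp : measure_display} {T : measurableType disp}.
Variables (P : probability T R) (F : finType) (m : nat).
Variables (a : F * 'I_m -> {RV P >-> R}).
Hypothesis m0 : (0 < m)%N.
Hypothesis indep_a : independent_RVs a.
Hypothesis norm_a : forall l, has_normal_law (a l) 0 (Num.sqrt m%:R^-1).

Variable s : nat -> seq {ffun F -> R}.

Lemma measurable_distortion_net (delta : R) :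
  measurable [set t | forall k x, x \in s k -> `|distortion (a ^~ t) x| <= delta].
Proof.
have -> : [set t | forall k x, x \in s k -> `|distortion (a ^~ t) x| <= delta] =
    \bigcap_k \bigcap_(x in [set` s k])
      [set t | `|distortion (a ^~ t) x| <= delta].
  apply/seteqP; split => [t h k _ x /= xs|t h k x xs]; first exact: (h k x xs).
  exact: (h k Logic.I x xs).
apply: bigcap_measurable => // k _; apply: fin_bigcap_measurable => // x _.
have -> : [set t | `|distortion (a ^~ t) x| <= delta] =
    setT `&` (fun t => `|distortion (a ^~ t) x|) @^-1` [set` `]-oo, delta]].
  by apply/seteqP; split => t /=; rewrite in_itv /= => // -[].
have mq : measurable_fun setT (fun t => `|distortion (a ^~ t) x|).
  by apply: measurableT_comp => //; exact: measurable_distortion.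
exact: mq.
Qed.

Variables (K M delta eps : R).
Hypothesis s0 : s 0%N = [:: 0].
Hypothesis s_le1 : forall k x, x \in s k -> l2norm x <= 1.
Hypothesis s_near : forall k x, x \in s k.+1 ->
  exists2 y, y \in s k & l2norm (x - y) <= 2^-1 ^+ k.
Hypothesis s_size : forall k, (size (s k))%:R <= expR ((5 + k%:R) * K).
Hypothesis K1 : 1 <= K.
Hypothesis KM : K <= M.
Hypothesis delta01 : 0 < delta < 1.
Hypothesis eps0 : 0 < eps.
Hypothesis epsM : ln eps^-1 <= M.
Hypothesis Mm : 15 * 72 ^+ 2 * delta ^- 2 * M <= m%:R.

(* At level [k], [links k] lists the vectors at which the distortion has to be
   controlled, and [thr k] is the bound required.  The Chernoff parameter
   [sigma] is the same at all levels: it is small against [delta], and the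
   linear growth of [thr k] is what beats the growth of the nets. *)
Let pairs k := [seq p : {ffun F -> R} * {ffun F -> R} <- [seq (x, y) | x <- s k.+1, y <- s k] |
  l2norm (p.1 - p.2) <= 2^-1 ^+ k].
Let links k := [seq link (2^-1 ^+ k) p.2 p.1.1 p.1.2
  | p <- [seq (p, b) | p <- pairs k, b <- [:: false; true]]].
Let sigma := delta / 144.
Let thr k := delta / 18 * k.+1%:R.
Let f k := exp_excess a sigma (thr k) (links k).

Let half_gt0 k : 0 < (2^-1 : R) ^+ k.
Proof. by rewrite exprn_gt0 // invr_gt0. Qed.

Let links_le1 k W : W \in links k -> \sum_i W i ^+ 2 <= 1.
Proof.
move=> /mapP[[[x y] b] /allpairsP[[[x' y'] b']] /= [+ _ [-> -> ->]] ->].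
rewrite mem_filter => /andP[/= xy /allpairsP[[x2 y2]] /= [xs ys [xE yE]]].
by apply: link_le1 => //; [rewrite xE; exact: s_le1 xs|rewrite yE; exact: s_le1 ys].
Qed.

Let size_links k : (size (links k))%:R <= 2 * expR ((11 + 2 * k%:R) * K).
Proof.
rewrite size_map size_allpairs /= natrM mulrC ler_wpM2l //.
apply: (@le_trans _ _ ((size (s k.+1))%:R * (size (s k))%:R)).
  by rewrite -natrM ler_nat size_filter (leq_trans (count_size _ _)) // size_allpairs.
rewrite (_ : (11 + 2 * k%:R) * K = (5 + k.+1%:R) * K + (5 + k%:R) * K).
  by rewrite expRD ler_pM.
by rewrite -natr1; ring.
Qed.

(* The exponent is at most [- 15 * (k + 1) * M].  This pays for the number of
   links, [(11 + 2 * k) * K]; for the factor 4 coming from two signs and two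
   polarization vectors, [2 * M]; for [2 ^ k.+1], [(k + 1) * M]; and for
   [eps^-1], [M]; with [K <= M] the total is at most [15 * (k + 1) * M]. *)
Let level_expectation k :
  (\int[P]_t (f k t)%:E <= (eps / (2 ^ k.+1)%:R)%:E)%E.
Proof.
have [d0 d1] := andP delta01.
have sigma0 : 0 < sigma by rewrite divr_gt0.
apply: le_trans (expectation_exp_excess_le m0 indep_a norm_a (thr k) _ _) _.
- by rewrite sigma0 /= /sigma; lra.
- exact: links_le1.
rewrite lee_fin; set e := _ - _.
have eE : e <= - (15 * k.+1%:R * M).
  pose g := m%:R * delta ^+ 2 / 72 ^+ 2.
  have Mg : 15 * M <= g.
    rewrite /g ler_pdivlMr ?exprn_gt0 // -ler_pdivrMr ?exprn_gt0 //.
    rewrite (_ : _ / _ = 15 * 72 ^+ 2 * delta ^- 2 * M) //; field.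
    by rewrite gt_eqF.
  have -> : e = - (g * (2 * k.+1%:R - 1)).
    by rewrite /e /sigma /thr /g; field.
  have k1 : 1 <= k.+1%:R :> R by rewrite ler1n.
  have g0 : 0 <= g by rewrite divr_ge0 ?mulr_ge0 ?exprn_ge0 ?(ltW d0).
  rewrite lerN2; set kk := k.+1%:R in k1 *.
  have h1 : kk * (15 * M) <= kk * g by rewrite ler_wpM2l // (le_trans ler01).
  have h2 : 0 <= g * (kk - 1) by rewrite mulr_ge0 // subr_ge0.
  by lra.
have M1 : 1 <= M := le_trans K1 KM.
have four : 4 <= expR (2 * M) :> R.
  apply: (@le_trans _ _ (expR (M + M))); last by rewrite mulr_natl mulr2n.
  rewrite expRD (_ : 4 = 2 * 2 :> R); last by lra.
  have M2 : 2 <= expR M by apply: le_trans (expR_ge1Dx M); lra.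
  by rewrite ler_pM.
have two : (2 ^ k.+1)%:R <= expR (k.+1%:R * M).
  rewrite natrX expRM_natl lerXn2r ?nnegrE ?expR_ge0 //.
  by apply: le_trans (expR_ge1Dx M); lra.
have epsE : eps^-1 <= expR M.
  by rewrite -[leLHS]lnK ?posrE ?invr_gt0 // ler_expR.
have p2 : 0 < (2 ^ k.+1)%:R :> R by rewrite ltr0n expn_gt0.
rewrite ler_pdivlMr // -[leRHS]mul1r -ler_pdivrMr //.
have sz := size_links k.
apply: (@le_trans _ _ ((2 * expR ((11 + 2 * k%:R) * M)) *
   (2 * expR (- (15 * k.+1%:R * M))) * expR (k.+1%:R * M) * expR M)).
  apply: ler_pM; rewrite ?mulr_ge0 ?expR_ge0 ?invr_ge0 ?(ltW eps0) ?ler0n //.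
  apply: ler_pM; rewrite ?mulr_ge0 ?expR_ge0 ?ler0n //.
  apply: ler_pM; rewrite ?mulr_ge0 ?expR_ge0 ?ler0n //.
  - apply: (le_trans sz); rewrite ler_wpM2l // ler_expR.
    by rewrite ler_wpM2l ?addr_ge0 ?mulr_ge0.
  - by rewrite ler_wpM2l // ler_expR.
rewrite (_ : _ * _ * _ * _ = 4 * expR ((11 + 2 * k%:R) * M
   + - (15 * k.+1%:R * M) + k.+1%:R * M + M)); last by rewrite !expRD; ring.
apply: (@le_trans _ _ (expR (2 * M) * expR ((11 + 2 * k%:R) * M
   + - (15 * k.+1%:R * M) + k.+1%:R * M + M))).
  by rewrite ler_wpM2r ?expR_ge0.
rewrite -expRD -[leRHS]expR0 ler_expR -natr1.
have : 0 <= k%:R * M by rewrite mulr_ge0 // (le_trans _ M1).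
by nra.
Qed.

(** Outside an event of probability at most [eps], all the links at all levels
have distortion at most [thr k]; then [chain_bound] applies with
[c = delta / 4]. *)
Lemma chaining_probability : ((1 - eps)%:E <=
  P [set t | forall k x, x \in s k -> (`|distortion (a ^~ t) x| <= delta)%R])%E.
Proof.
have [d0 d1] := andP delta01.
have sigma0 : 0 < sigma by rewrite divr_gt0.
have mf k : measurable_fun setT (f k) by exact: measurable_exp_excess.
have := probability_all_le1 (ltW eps0) mf
  (fun k t => exp_excess_ge0 _ _ _ _ _) level_expectation.
move=> /le_trans; apply; apply: le_measure; rewrite ?inE.
- apply: bigcap_measurable => // k _.
  have -> : [set t | f k t <= 1] = setT `&` f k @^-1` [set` `]-oo, 1]].
    by apply/seteqP; split => t /=; rewrite in_itv /= => // -[].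
  exact: mf.
- exact: measurable_distortion_net.
move=> t ft k x xs /=.
pose q := distortion (a ^~ t).
have -> : delta = 4 * (delta / 4) by field.
apply: (@chain_bound _ _ q s) xs => //; first by rewrite divr_ge0 // ltW.
  exact: distortion0.
move=> {k x} k x y xs ys xy.
have lk b : `|q (link (2^-1 ^+ k) b x y)| <= thr k.
  apply: (exp_excess_le1 m0 sigma0 _ (ft k I)).
  apply/mapP; exists ((x, y), b) => //.
  apply/allpairsP; exists ((x, y), b); split => //=; last by case: b.
  by rewrite mem_filter xy; apply/allpairsP; exists (x, y).
rewrite /q (distortion_link _ _ _ (lt0r_neq0 (half_gt0 k))) -/q.
have := lk false; have := lk true; rewrite !ler_norml /thr.
move: (q _) (q _) (half_gt0 k) => u v; set p := 2^-1 ^+ k; set kk := k.+1%:R.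
move=> p0 /andP[h1 h2] /andP[h3 h4].
have hp : `|u - v| <= 2 * (delta / 18 * kk) by rewrite ler_norml; apply/andP; split; lra.
rewrite -ler_norml normrM ger0_norm; last by rewrite divr_ge0 // mulr_ge0 // ltW.
apply: (le_trans (ler_wpM2l _ hp)); first by rewrite divr_ge0 // mulr_ge0 // ltW.
by rewrite le_eqVlt; apply/orP; left; apply/eqP; field.
Qed.

End chaining_probability.

(** * From the nets to the whole set *)

Lemma ler_norm_sum_mul {R : realType} {I : finType} (x y : I -> R) :
  `|\sum_i x i * y i| <= l2norm x * l2norm y.
Proof.
rewrite -(ler_pXn2r (n := 2)) ?nnegrE ?mulr_ge0 ?l2norm_ge0 //.
by rewrite exprMn !sqr_l2norm real_normK ?num_real // cauchy_schwarz_sum.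
Qed.

(** Factor the difference of the two quadratic forms as in
[u ^+ 2 - v ^+ 2 = (u - v) * (u + v)] and apply Cauchy-Schwarz.  The constant
depends on the matrix, which is enough for continuity. *)
Lemma distortion_lipschitz {R : realType} {F : finType} {m : nat}
    (a : F * 'I_m -> R) :
  exists2 L, 0 <= L & forall x y : {ffun F -> R}, l2norm x <= 1 -> l2norm y <= 1 ->
    `|distortion a x - distortion a y| <= L * l2norm (x - y).
Proof.
pose c k := l2norm (fun i => a (i, k)).
exists (2 * (\sum_k c k ^+ 2 + 1)).
  by rewrite mulr_ge0 // addr_ge0 // sumr_ge0 // => k _; exact: sqr_ge0.
move=> x y x1 y1; set e := l2norm (x - y).
have e0 : 0 <= e by exact: l2norm_ge0.
pose z i := x i + y i.
have z2 : l2norm z <= 2.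
  by apply: le_trans (l2norm_triangle x y) _; lra.
have -> : distortion a x - distortion a y =
    \sum_k (\sum_i a (i, k) * (x - y) i) * (\sum_i a (i, k) * z i)
    - \sum_i (x - y) i * z i.
  have S (p q p' q' : R) : p - q - (p' - q') = (p - p') - (q - q') by ring.
  rewrite /distortion S -!sumrB; congr (_ - _).
    apply: eq_bigr => k _; rewrite subr_sqr -sumrB -big_split /=.
    by congr (_ * _); apply: eq_bigr => i _; rewrite /z ?ffunE; ring.
  by apply: eq_bigr => i _; rewrite /z !ffunE; ring.
apply: le_trans (ler_normB _ _) _.
rewrite mulrDr mulr1 mulrDl; apply: lerD; last first.
  by apply: le_trans (ler_norm_sum_mul _ _) _; rewrite mulrC ler_wpM2r.
apply: le_trans (ler_norm_sum _ _ _) _.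
rewrite mulr_sumr mulr_suml; apply: ler_sum => k _.
rewrite normrM (_ : 2 * c k ^+ 2 * e = (c k * e) * (c k * 2)); last by ring.
apply: ler_pM => //; first exact: ler_norm_sum_mul.
apply: le_trans (ler_norm_sum_mul _ _) _.
by rewrite ler_wpM2l // l2norm_ge0.
Qed.

Lemma TRIP_unitP {R : realType} {d : nat} {n : 'I_d -> nat} {m : nat}
    (a : midx n * 'I_m -> R) (S : set (tensor R n)) (delta : R) :
  (forall X, S X -> frobenius X = 1) ->
  TRIP (tensor_map [ffun ik => a ik]) S delta <->
  (forall X, S X -> `|distortion a X| <= delta).
Proof.
move=> S1.
have E X : S X -> distortion a X = norm2 (tensor_map [ffun ik => a ik] X) ^+ 2 - 1.
  move=> SX; rewrite /distortion -[X in _ - X]sqr_l2norm.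
  rewrite -[l2norm X]/(frobenius X) (S1 _ SX) expr1n sqr_l2norm; congr (_ - _).
  apply: eq_bigr => k _; rewrite mxE; congr (_ ^+ 2).
  by apply: eq_bigr => i _; rewrite ffunE.
split=> h X SX.
  have := h X SX; rewrite (S1 _ SX) expr1n !mulr1 E // ler_norml => -[h1 h2].
  by apply/andP; split; lra.
have := h X SX; rewrite (S1 _ SX) expr1n !mulr1 E // ler_norml => /andP[h1 h2].
by split; lra.
Qed.

(** The bound passes from the nets to their closure by continuity. *)
Lemma distortion_dense {R : realType} {F : finType} {m : nat}
    (a : F * 'I_m -> R) (s : nat -> seq {ffun F -> R}) (delta : R) (X : {ffun F -> R}) :
  (forall k x, x \in s k -> l2norm x <= 1 /\ `|distortion a x| <= delta) ->
  l2norm X <= 1 ->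
  (forall k, exists2 y, y \in s k & l2norm (X - y) <= 2^-1 ^+ k) ->
  `|distortion a X| <= delta.
Proof.
move=> hs X1 near; have [L L0 lip] := distortion_lipschitz a.
apply/ler_addgt0Pr => e e0.
pose k := Num.truncn (L / e).
have [y ys Xy] := near k; have [y1 yd] := hs k y ys.
rewrite -(subrK (distortion a y) (distortion a X)) addrC.
apply: le_trans (ler_normD _ _) _; apply: lerD => //.
apply: le_trans (lip X y X1 y1) _.
apply: le_trans (ler_wpM2l L0 Xy) _.
rewrite exprVn ler_pdivrMr ?exprn_gt0 // mulrC -ler_pdivrMr //.
apply: (le_trans (ltW (truncnS_gt _))).
by rewrite -/k -natrX ler_nat ltn_expl.
Qed.

Theorem theorem2p5 (R : realType) :
  exists C : R, 0 < C /\
    forall (d : nat) (n : 'I_d -> nat) (m r : nat) (rho delta eps : R)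
      (disp : measure_display) (T : measurableType disp)
      (P : probability T R) (a : midx n * 'I_m -> {RV P >-> R}),
      (2 <= d)%N -> (forall j : 'I_d, (0 < n j)%N) ->
      (0 < m)%N -> (0 < r)%N -> 0 < rho ->
      0 < delta < 1 -> 0 < eps < 1 ->
      independent_RVs a ->
      (forall ik : midx n * 'I_m,
         has_normal_law (a ik) 0 (Num.sqrt (m%:R^-1))) ->
      C * delta ^- 2 *
        Num.max (ln eps^-1)
          (r%:R * ln (d%:R * r%:R * rho ^+ d) * \sum_(j < d) (n j)%:R)
        <= m%:R ->
      let E : set T :=
        [set w | TRIP (tensor_map [ffun ik => a ik w])
                   (@bounded_cp_set R d n r rho) delta] in
      measurable E /\ ((1 - eps)%:E <= P E)%E.
Proof.
exists (15 * 72 ^+ 2); split; first by rewrite mulr_gt0 // exprn_gt0.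
move=> d n m r rho delta eps disp T P a d2 n0 m0 r0 rho0 delta01.
move=> /andP[eps0 eps1] indep_a norm_a; set M := Num.max _ _ => Mm E.
pose S := @bounded_cp_set R d n r rho.
have S1 X : S X -> frobenius X = 1 by case.
have [[X0 SX0]|S0] := pselect (S !=set0); last first.
  have -> : E = setT.
    by apply/seteqP; split => // w _ X SX; case: S0; exists X.
  by split => //; rewrite probability_setT lee_fin; lra.
have SX : S !=set0 by exists X0.
have [K1 [s [s0 sS s_near s_size]]] := bounded_cp_nets d2 n0 r0 rho0 SX.
have l2norm0 : l2norm (0 : {ffun midx n -> R}) = 0.
  by rewrite /l2norm big1 ?sqrtr0 // => i _; rewrite ffunE expr0n.
have s_le1 k X : X \in s k -> l2norm X <= 1.
  case: k => [|k]; last by move=> /sS /S1 /eqP; rewrite eq_le => /andP[].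
  by rewrite s0 inE => /eqP ->; rewrite l2norm0.
have -> : E = [set t | forall k X, X \in s k -> `|distortion (a ^~ t) X| <= delta].
  apply/seteqP; split => t.
    move=> /(TRIP_unitP _ _ S1) h [|k] X; last by move=> /sS; exact: h.
    by rewrite s0 inE => /eqP ->; rewrite distortion0 normr0 ltW //; case/andP: delta01.
  move=> h; apply/(TRIP_unitP _ _ S1) => X SX'.
  apply: (@distortion_dense _ _ _ _ s) => [k Y Ys||k].
  - by split; [exact: s_le1 Ys|exact: h Ys].
  - by rewrite -[l2norm X]/(frobenius X) S1.
  - exact: s_near.
split; first exact: measurable_distortion_net.
apply: (@chaining_probability _ _ _ _ _ _ _ _ _ _ s _ M delta eps s0 s_le1 _ s_size K1) => //.
- by move=> k X /sS; exact: s_near.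
- by rewrite /M le_max lexx orbT.
- by rewrite /M le_max lexx.
Qed.
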